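(* Let $k$ be a finite field with an odd number $q$ of elements. For any $m\geq 1$, any pair $(\mathbf{n};\mathbf{r})\in\mathcal{N}_m$ and any integer $g\ge -1$, $$\sum_{j=0}^{g+1}\hat b_j\,u_{g-j}=\begin{cases} J\,\hat b_{2g+2} & \text{if } r_i=2 \text{ for all } i \text{ and } g\ge -1;\\ 0 & \text{if } r_i=1 \text{ for some } i \text{ and } g\ge \frac{|\mathbf{n}|-3}{2},\end{cases}$$ where $u_g=u_g^{(\mathbf{n};\mathbf{r})}$, $\hat b_j=\hat b_j^{\mathbf{n}}$ and $J=J^{\mathbf n}$.
   Context: Let $k$ be a finite field with $q$ elements, $q$ odd, $k_m$ its extension of degree $m$ (inside an algebraic closure $\bar k$), and $F$ the Frobenius $x\mapsto x^q$ acting on $\mathbb{P}^1(\bar k)$. For $g\ge -1$ let $P_g$ be the set of square-free polynomials over $k$ of degree $2g+1$ or $2g+2$ (for $g=-1$: the nonzero constants). For $f\in P_g$ let $f(\infty)$ be the coefficient of $x^{2g+2}$ in $f$. Let $\chi_{2,m}$ be the quadratic character of $k_m$: it is $1$ on nonzero squares, $-1$ on nonsquares, $0$ at $0$. Put $I:=(q^3-q)^{-1}(q-1)^{-1}$. $\mathcal{N}_m$ is the set of pairs $(\mathbf{n};\mathbf{r})$ with $\mathbf{n}=(n_1,\dots,n_m)\in\mathbb{Z}_{\ge1}^m$ and $\mathbf{r}=(r_1,\dots,r_m)\in\{1,2\}^m$; $|\mathbf{n}|:=\sum_i n_i$. $A(\mathbf{n})$ is the set of tuples $(\alpha_1,\dots,\alpha_m)\in\prod_{i=1}^m\mathbb{P}^1(k_{n_i})$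 such that for all $1\le i,j\le m$ and $s\ge0$: $F^s(\alpha_i)=\alpha_j$ implies $n_i\mid s$ and $i=j$. Put $A'(\mathbf{n}):=A(\mathbf{n})\cap\prod_i\mathbb{A}^1(k_{n_i})$. For $g\ge-1$, $$u_g^{(\mathbf{n};\mathbf{r})}:=\sum_{\alpha\in A(\mathbf{n})} I\sum_{f\in P_g}\prod_{i=1}^m\chi_{2,n_i}\bigl(f(\alpha_i)\bigr)^{r_i}.$$ For $j\ge0$, $b_j=b_j^{\mathbf{n}}$ is the number of monic polynomials $l$ over $k$ of degree $j$ with $l(\alpha_i)\ne0$ for all $i$, for any $\alpha\in A'(\mathbf{n})$; this does not depend on $\alpha$ and is given by $$b_j=q^j+\sum_{i=1}^j(-1)^i\sum_{\substack{1\le m_1<\dots<m_i\le m\\ n_{m_1}+\dots+n_{m_i}\le j}}q^{\,j-(n_{m_1}+\dots+n_{m_i})},$$ which is taken as the definition also if $A'(\mathbf{n})$ is empty. Put $\hat b_j=\hat b_j^{\mathbf n}:=\sum_{i=0}^j b_i$ and $J:=I\,(q-1)\,|A(\mathbf{n})|$. *)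

(* Defs.v *)
From HB Require Import structures.
From mathcomp Require Export all_boot all_order all_algebra fieldext.
From mathcomp Require Export finmap.
From mathcomp Require Export mathcomp_extra boolp classical_sets functions.
From mathcomp Require Export cardinality fsbigop.

#[export] Set Implicit Arguments.
#[export] Unset Strict Implicit.
#[export] Unset Printing Implicit Defensive.

Export Order.TTheory GRing.Theory Num.Theory.
Open Scope classical_set_scope.
Open Scope ring_scope.

(* An algebraic closure of the finite field k is an algebraically closed field
   K with an algebraic embedding iota : k -> K (integralRange iota).

   The sums \sum_(x \in X) F x and the cardinals #|` fset_set X| range over
   classical sets and have a junk value only when X is infinite; all the sets
   X below are finite. *)

(* k_d, the extension of degree d of k inside K.  As k is finite, it has a
   unique extension of degree d inside K, so that every E and j below have the
   same image. *)
Definition ext (k : finFieldType) (K : closedFieldType)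
    (iota : {rmorphism k -> K}) (d : nat) : set K :=
  [set x | exists (E : fieldExtType k) (j : {rmorphism E -> K}),
     [/\ \dim {:E} = d, forall c : k, j c%:A = iota c & exists y, j y = x]].

(* chi_{2,d}; its values are only meaningful on k_d *)
Definition chi2 (k : finFieldType) (K : closedFieldType)
    (iota : {rmorphism k -> K}) (d : nat) (x : K) : rat :=
  if x == 0 then 0
  else if `[< exists2 y, ext iota d y & x = y ^+ 2 >] then 1 else -1.

(* P^1(K) is option K, with None the point at infinity *)
Definition P1ext (k : finFieldType) (K : closedFieldType)
    (iota : {rmorphism k -> K}) (d : nat) : set (option K) :=
  [set a | if a is Some x then ext iota d x else True].

Definition frob (k : finFieldType) (K : closedFieldType) (a : option K) :
    option K :=
  omap (fun x => x ^+ #|k|) a.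

(* this excludes f = 0, as 'X ^+ 2 %| 0 *)
Definition square_free (k : fieldType) (f : {poly k}) : Prop :=
  forall d : {poly k}, d ^+ 2 %| f -> size d = 1%N.

(* a nonzero polynomial f has degree (size f) - 1 *)
Definition P (k : finFieldType) (g : int) : set {poly k} :=
  [set f | square_free f /\
     ((size f)%:Z - 1 = 2 * g + 1 \/ (size f)%:Z - 1 = 2 * g + 2)].

(* the value at a of f, seen as an element of P_g, for g >= -1 *)
Definition evalP1 (k : finFieldType) (K : closedFieldType)
    (iota : {rmorphism k -> K}) (g : int) (f : {poly k}) (a : option K) : K :=
  if a is Some x then (map_poly iota f).[x] else iota f`_(absz (2 * g + 2)).

Definition in_calN (m : nat) (n r : 'I_m -> nat) : Prop :=
  forall i, (1 <= n i)%N /\ (r i = 1%N \/ r i = 2%N).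

Definition A (k : finFieldType) (K : closedFieldType)
    (iota : {rmorphism k -> K}) (m : nat) (n : 'I_m -> nat) :
    set {ffun 'I_m -> option K} :=
  [set alpha | (forall i, P1ext iota (n i) (alpha i)) /\
     forall (i j : 'I_m) (s : nat),
       iter s (@frob k K) (alpha i) = alpha j -> (n i %| s)%N /\ i = j].

Definition A' (k : finFieldType) (K : closedFieldType)
    (iota : {rmorphism k -> K}) (m : nat) (n : 'I_m -> nat) :
    set {ffun 'I_m -> option K} :=
  [set alpha | A iota n alpha /\ forall i, alpha i <> None].

Definition I (k : finFieldType) : rat :=
  let q : rat := #|k|%:R in (q ^+ 3 - q)^-1 * (q - 1)^-1.

Definition u (k : finFieldType) (K : closedFieldType)
    (iota : {rmorphism k -> K}) (m : nat) (n r : 'I_m -> nat) (g : int) : rat :=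
  \sum_(alpha \in A iota n)
    I k * \sum_(f \in @P k g)
      \prod_(i < m) chi2 iota (n i) (evalP1 iota g f (alpha i)) ^+ r i.

Definition b_count (k : finFieldType) (K : closedFieldType)
    (iota : {rmorphism k -> K}) (m : nat) (alpha : {ffun 'I_m -> option K})
    (j : nat) : nat :=
  #|` fset_set [set l : {poly k} | [/\ l \is monic, size l = j.+1
        & forall (i : 'I_m) (x : K), alpha i = Some x ->
            (map_poly iota l).[x] <> 0]]|.

(* the indices m_1 < ... < m_i are encoded by the set S of cardinal i that they
   form *)
Definition b_formula (q m : nat) (n : 'I_m -> nat) (j : nat) : int :=
  q%:Z ^+ j + \sum_(1 <= i < j.+1) (-1) ^+ i *
    \sum_(S : {set 'I_m} | (#|S| == i) && (\sum_(t in S) n t <= j)%N)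
      q%:Z ^+ (j - \sum_(t in S) n t).

(* the count does not depend on the choice of alpha in A'(n) *)
Definition b (k : finFieldType) (K : closedFieldType)
    (iota : {rmorphism k -> K}) (m : nat) (n : 'I_m -> nat) (j : nat) : int :=
  if `[< A' iota n !=set0 >]
  then (b_count iota (xget [ffun=> None] (A' iota n)) j)%:Z
  else b_formula #|k| n j.

Definition bhat (k : finFieldType) (K : closedFieldType)
    (iota : {rmorphism k -> K}) (m : nat) (n : 'I_m -> nat) (j : nat) : int :=
  \sum_(0 <= i < j.+1) b iota n i.

Definition J (k : finFieldType) (K : closedFieldType)
    (iota : {rmorphism k -> K}) (m : nat) (n : 'I_m -> nat) : rat :=
  I k * (#|k|%:R - 1) * #|` fset_set (A iota n)|%:R.

(* Main.v *)
(* Fix alpha in A(n) and put G = g + 1.  Every nonzero polynomial is uniquely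
   l ^+ 2 * f with l monic and f square-free, so summing u_{g-j} against the
   number of monic l of degree j not vanishing at the finite alpha_i gives the
   sum of prod_i chi(h(alpha_i)) ^ r_i over the h of degree 2g+1 or 2g+2.  If no
   alpha_i is infinite, summing this over the smaller genera as well turns b_j
   into bhat_j and yields the sum over all h of degree at most 2g+2.  If some
   alpha_i is infinite, then n_i = 1 and inclusion-exclusion shows that bhat_j
   itself counts the l that avoid the remaining points, while only the h of
   degree exactly 2g+2 contribute, so the same sum over all h appears.
   If all r_i = 2, this sum counts the h not vanishing at any alpha_i.  If
   r_i = 1, it vanishes because h may be translated by M * w, where M vanishes
   at the other points and w(alpha_i) runs over k_{n_i}, on which chi sums to
   zero; |n| <= 2g+3 leaves room for M * w.  So the identity holds for each
   alpha separately. *)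
Require Import Defs.
From mathcomp Require Import finfield falgebra ring lra zify.

(** * Polynomials of bounded degree and square-free parts *)

Definition polys (k : finFieldType) (N : nat) : seq {poly k} :=
  [seq rVpoly v | v : 'rV[k]_N].

Lemma mem_polys (k : finFieldType) N (p : {poly k}) :
  (p \in polys k N) = (size p <= N)%N.
Proof.
apply/mapP/idP => [[v _ ->]|sp]; first exact: size_poly.
by exists (poly_rV p); rewrite ?poly_rV_K // mem_enum.
Qed.

Lemma polys_uniq (k : finFieldType) N : uniq (polys k N).
Proof.
rewrite map_inj_in_uniq ?enum_uniq // => v w _ _.
exact: (can_inj rVpolyK).
Qed.

Lemma size_polys (k : finFieldType) N : size (polys k N) = (#|k| ^ N)%N.
Proof. by rewrite size_map -cardE card_mx mul1n. Qed.

(** [phi] and [psi] need be mutually inverse only on the two filtered lists; this allows division,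
    translation and scaling as changes of variable between different degree bounds. *)
Lemma big_polys_reindex (k : finFieldType) (V : nmodType) (N N' : nat)
    (Q R : pred {poly k}) (phi psi : {poly k} -> {poly k}) (F : {poly k} -> V) :
  (forall l : {poly k}, (size l <= N')%N -> R l ->
     [/\ (size (phi l) <= N)%N, Q (phi l) & psi (phi l) = l]) ->
  (forall h : {poly k}, (size h <= N)%N -> Q h ->
     [/\ (size (psi h) <= N')%N, R (psi h) & phi (psi h) = h]) ->
  \sum_(h <- polys k N | Q h) F h = \sum_(l <- polys k N' | R l) F (phi l).
Proof.
move=> H1 H2; rewrite -[LHS]big_filter -[RHS]big_filter -(big_map phi xpredT F).
apply: perm_big; apply: uniq_perm; first by rewrite filter_uniq ?polys_uniq.
  rewrite map_inj_in_uniq ?filter_uniq ?polys_uniq // => a a'.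
  rewrite !mem_filter !mem_polys => /andP[Ra sa] /andP[Ra' sa'] e.
  by have [_ _ <-] := H1 a sa Ra; have [_ _ <-] := H1 a' sa' Ra'; rewrite e.
move=> h; rewrite mem_filter mem_polys; apply/andP/mapP => [[Qh sh]|[l]].
  have [s' R' e] := H2 h sh Qh.
  by exists (psi h); rewrite ?mem_filter ?mem_polys ?R' ?s'.
rewrite mem_filter mem_polys => /andP[Rl sl] ->.
by have [s' Q' _] := H1 l sl Rl.
Qed.

Lemma finite_bounded (k : finFieldType) N (X : set {poly k}) :
  (forall f, X f -> (size f <= N)%N) -> finite_set X.
Proof.
move=> H; apply: (@sub_finite_set _ _ [set` polys k N]).
  by move=> f /H; rewrite /= mem_polys.
exact: finite_seq.
Qed.

Lemma perm_fset_set (k : finFieldType) N (X : set {poly k}) :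
  (forall f, X f -> (size f <= N)%N) ->
  perm_eq (fset_set X) [seq f <- polys k N | f \in X].
Proof.
move=> H; apply: uniq_perm; rewrite ?fset_uniq ?filter_uniq ?polys_uniq //.
move=> f; rewrite in_fset_set ?mem_filter ?mem_polys; last exact: finite_bounded H.
by case: (boolP (f \in X)) => //= /[!inE] /H ->.
Qed.

Lemma fsbig_polys (k : finFieldType) (V : nmodType) N (X : set {poly k})
    (F : {poly k} -> V) : (forall f, X f -> (size f <= N)%N) ->
  \sum_(f \in X) F f = \sum_(f <- polys k N | f \in X) F f.
Proof.
move=> H; rewrite fsbig_finite; last exact: finite_bounded H.
by rewrite -[RHS]big_filter; apply/perm_big/perm_fset_set.
Qed.

Lemma card_polys (k : finFieldType) N (X : set {poly k}) :
  (forall f, X f -> (size f <= N)%N) ->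
  #|` fset_set X| = (\sum_(f <- polys k N | f \in X) 1)%N.
Proof.
by move=> H; rewrite sum1_count -size_filter; apply/perm_size/perm_fset_set.
Qed.

Lemma sum_polys_leq (k : finFieldType) (V : nmodType) N N' (Q : pred {poly k})
    (F : {poly k} -> V) : (forall h, Q h -> (size h <= N)%N && (size h <= N')%N) ->
  \sum_(h <- polys k N | Q h) F h = \sum_(h <- polys k N' | Q h) F h.
Proof.
move=> H; apply: (@big_polys_reindex _ _ _ _ _ _ id id) => h _ Qh;
  by case/andP: (H _ Qh).
Qed.

(** The sizes on the right start at 1, which is why [Q] must reject the zero polynomial. *)
Lemma sum_by_size (k : finFieldType) (V : nmodType) N (Q : pred {poly k})
    (F : {poly k} -> V) : ~~ Q 0 ->
  \sum_(h <- polys k N | Q h) F h =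
  \sum_(0 <= j < N) \sum_(h <- polys k j.+1 | Q h && (size h == j.+1)) F h.
Proof.
move=> Q0; rewrite big_mkord.
have eN (j : 'I_N) : \sum_(h <- polys k j.+1 | Q h && (size h == j.+1)) F h =
    \sum_(h <- polys k N | Q h && (size h == j.+1)) F h.
  by apply: sum_polys_leq => h /andP[_ /eqP->]; rewrite leqnn ltn_ord.
rewrite (eq_bigr _ (fun j _ => eN j)).
rewrite [RHS](exchange_big_dep Q) /=; last by move=> j h _ /andP[].
rewrite big_seq_cond [RHS]big_seq_cond; apply: eq_bigr => h /andP[].
rewrite mem_polys => sh Qh.
have h0 : (0 < size h)%N by rewrite size_poly_gt0; apply: contraNneq Q0 => <-.
have hN : ((size h).-1 < N)%N by lia.
rewrite (big_pred1 (Ordinal hN)) // => j; rewrite Qh -[RHS](inj_eq val_inj) /=.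
by rewrite [RHS]eq_sym -[RHS](inj_eq succn_inj) prednK.
Qed.

(** * Square parts of polynomials: existence and uniqueness *)

Section SquareFree.
Variable k : finFieldType.
Implicit Types f h l d : {poly k}.

(* This instance of [size_mul] makes the coercions out of [finFieldType]
   syntactically equal, without which [lia] does not identify the sizes. *)
Lemma size_polyM f h : f != 0 -> h != 0 -> size (f * h) = (size f + size h).-1.
Proof. exact: size_mul. Qed.

Lemma dvdp_size_leq f h : h != 0 -> f %| h -> (size f <= size h)%N.
Proof. exact: dvdp_leq. Qed.

(** Induction on the size: a polynomial that is not square-free has a divisor d^2 with d
    nonconstant, and the quotient is smaller. *)
Lemma sqfree_ex h : h != 0 ->
  exists l, [/\ l \is monic, l ^+ 2 %| h & square_free (h %/ l ^+ 2)].
Proof.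
have [n] := ubnP (size h); elim: n h => // n IH h sh h0.
case: (pselect (square_free h)) => [sq|nsq].
  by exists 1; rewrite monic1 expr1n dvd1p divp1.
have [d [dd sd]] : exists d, d ^+ 2 %| h /\ size d <> 1%N.
  by have /existsNP[d /not_implyP[dd sd]] := nsq; exists d.
pose h' : {poly k} := h %/ d ^+ 2.
have eh : h' * d ^+ 2 = h by rewrite divpK.
have h'0 : h' != 0 by apply: contra_neq h0 => e; rewrite -eh e mul0r.
have d0 : d != 0 by apply: contra_neq h0 => e; rewrite -eh e expr0n mulr0.
have d1 : (1 < size d)%N.
  by have := size_poly_gt0 d; rewrite d0; lia.
have sh' : (size h' < n)%N.
  move: sh; rewrite -eh expr2 !size_polyM ?mulf_neq0 //.
  have := size_poly_gt0 h'; rewrite h'0; lia.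
have [l [ml dl sl]] := IH h' sh' h'0.
have c0 : lead_coef d != 0 by rewrite lead_coef_eq0.
(* Making [d] monic changes the quotient only by a nonzero scalar, which preserves
   square-freeness. *)
pose d1' := (lead_coef d)^-1 *: d.
have md : d1' \is monic by rewrite monicE lead_coefZ mulVf.
have edl : (d1' * l) ^+ 2 = (lead_coef d)^-1 ^+ 2 *: (d ^+ 2 * l ^+ 2).
  by rewrite exprMn exprZn -scalerAl.
have e2 : h = (h' %/ l ^+ 2) * (d ^+ 2 * l ^+ 2).
  by rewrite [d ^+ 2 * _]mulrC mulrA divpK // eh.
have c20 : (lead_coef d)^-1 ^+ 2 != 0 by rewrite expf_neq0 ?invr_neq0.
exists (d1' * l); split; first by rewrite monicMl.
  by rewrite edl dvdpZl // e2 dvdp_mull.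
rewrite edl divpZr // [X in X %/ _]e2 mulpK; last first.
  by rewrite mulf_neq0 ?expf_neq0 // monic_neq0.
move=> e de; apply: sl; move: de; rewrite dvdpZr // invr_neq0 //.
Qed.

(** By symmetry it is enough that b divides a. With d = gcd(a, b), the square of b/d is coprime to
    that of a/d, so it divides h/a^2; as this is square-free, b/d is constant. *)
Lemma sqfree_uniq h l l' : h != 0 -> l \is monic -> l' \is monic ->
  l ^+ 2 %| h -> l' ^+ 2 %| h ->
  square_free (h %/ l ^+ 2) -> square_free (h %/ l' ^+ 2) -> l = l'.
Proof.
move=> h0 ml ml' dl dl' sl sl'.
suff H : forall a b : {poly k}, a \is monic -> b \is monic -> a ^+ 2 %| h ->
    b ^+ 2 %| h -> square_free (h %/ a ^+ 2) -> b %| a.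
  by apply/eqP; rewrite -eqp_monic //; apply/andP; split; apply: H.
move=> {l l' ml ml' dl dl' sl sl'} a b ma mb da db sa.
have b0 := monic_neq0 mb; have a0 := monic_neq0 ma.
pose d := gcdp a b.
have d0 : d != 0 by rewrite gcdp_eq0 negb_and a0.
have ea : a %/ d * d = a by rewrite divpK // dvdp_gcdl.
have eb : b %/ d * d = b by rewrite divpK // dvdp_gcdr.
have cop : coprimep ((b %/ d) ^+ 2) ((a %/ d) ^+ 2).
  by rewrite coprimep_expl // coprimep_expr // coprimep_sym coprimep_div_gcd // a0.
have : (b %/ d) ^+ 2 %| h %/ a ^+ 2.
  rewrite -(Gauss_dvdpl _ cop) -(@dvdp_mul2r _ (d ^+ 2)) ?expf_neq0 //.
  by rewrite -mulrA -!exprMn ea eb divpK.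
move=> /sa /eqP; rewrite size_poly_eq1 => /eqp_dvdl e1.
by rewrite -eb -[a]mul1r dvdp_mul ?dvdp_gcdl // e1 dvd1p.
Qed.

End SquareFree.

(** * Values at a point of exact degree d *)

Section Points.
Variables (k : finFieldType) (K : closedFieldType) (iota : {rmorphism k -> K}).
Implicit Types (x y z : K) (h p w : {poly k}) (d s : nat).
Local Notation q := #|k|.

Definition ev h x : K := (map_poly iota h).[x].

Lemma evD h h' x : ev (h + h') x = ev h x + ev h' x.
Proof. by rewrite /ev rmorphD hornerD. Qed.
Lemma ev0 x : ev 0 x = 0.
Proof. by rewrite /ev rmorph0 horner0. Qed.
Lemma evC c x : ev c%:P x = iota c.
Proof. by rewrite /ev map_polyC hornerC. Qed.
Lemma ev_X x : ev 'X x = x.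
Proof. by rewrite /ev map_polyX hornerX. Qed.
Lemma evB h h' x : ev (h - h') x = ev h x - ev h' x.
Proof. by rewrite /ev rmorphB hornerD hornerN. Qed.
Lemma evM h h' x : ev (h * h') x = ev h x * ev h' x.
Proof. by rewrite /ev rmorphM hornerM. Qed.
Lemma evX h n x : ev (h ^+ n) x = ev h x ^+ n.
Proof. by rewrite /ev rmorphXn horner_exp. Qed.

Lemma ev_at0 h : ev h 0 = iota h`_0.
Proof. by rewrite /ev horner_coef0 coef_map. Qed.
Lemma ev_prod (T : finType) (Q : pred T) (F : T -> {poly k}) x :
  ev (\prod_(i | Q i) F i) x = \prod_(i | Q i) ev (F i) x.
Proof. by rewrite /ev rmorph_prod horner_prod. Qed.

Lemma iter_frob s x : iter s (@frob k K) (Some x) = Some (x ^+ (q ^ s)).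
Proof.
elim: s => [|s IH]; first by rewrite expr1.
by rewrite iterS IH /= -exprM -expnSr.
Qed.

Lemma ext_fermat d x : ext iota d x -> x ^+ (q ^ d) = x.
Proof.
move=> [E [j [dE _ [y <-]]]]; rewrite -rmorphXn /=; congr (j _).
have := Fermat's_little_theorem {:E}%AS y.
by rewrite memvf dE => /esym/eqP.
Qed.

(** The minimal polynomial of y in E has degree e = dim k(y) <= d. Fermat's little theorem in k(y)
    gives x^(q^e) = x, so the hypothesis on x makes d divide e, whence e = d. *)
Lemma ext_minpoly d x : (0 < d)%N -> ext iota d x ->
    (forall s, x ^+ (q ^ s) = x -> (d %| s)%N) ->
  exists p, [/\ p \is monic, size p = d.+1 & forall h, (ev h x == 0) = (p %| h)].
Proof.
move=> d0 [E [j [dE jc [y <-]]]] Hx.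
have evj h : ev h (j y) = j (map_poly (in_alg E) h).[y].
  rewrite /ev -horner_map -map_poly_comp; congr _.[_].
  by apply: eq_map_poly => c /=; rewrite jc.
have [p ep] := polyOver1P (minPolyOver 1%AS y).
have mp : p \is monic by rewrite -(map_monic (in_alg E)) -ep monic_minPoly.
exists p; split=> // [|h].
  have -> : size p = (adjoin_degree 1%AS y).+1.
    by rewrite -(size_map_poly (in_alg E)) -ep size_minPoly.
  have eD : adjoin_degree 1%AS y = \dim <<1%AS; y>>%AS.
    by rewrite dim_Fadjoin dimv1 muln1.
  congr _.+1; apply/eqP; rewrite eqn_leq; apply/andP; split.
    by rewrite eD -dE dimvS // subvf.
  apply: dvdn_leq; first by rewrite eD adim_gt0.
  apply: Hx; rewrite -rmorphXn /=; congr (j _).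
  have := Fermat's_little_theorem <<1%AS; y>>%AS y.
  by rewrite memv_adjoin eD => /esym/eqP.
rewrite evj fmorph_eq0 -(dvdp_map (in_alg E)) -ep.
apply/idP/idP => [r0|dv].
  by apply: minPoly_dvdp => //; apply/polyOver1P; exists h.
rewrite -[_ == 0]/(root _ y) -dvdp_XsubCl; apply: dvdp_trans dv.
by rewrite dvdp_XsubCl root_minPoly.
Qed.

(* x has degree exactly d over k, with minimal polynomial p *)
Definition exact_point d x p :=
  [/\ (0 < d)%N, ext iota d x, p \is monic, size p = d.+1
    & forall h, (ev h x == 0) = (p %| h)].

Lemma ext_ev d x h : ext iota d x -> ext iota d (ev h x).
Proof.
move=> [E [j [dE jc [y <-]]]]; exists E, j; split=> //.
exists (map_poly (in_alg E) h).[y].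
rewrite /ev -horner_map -map_poly_comp; congr _.[_].
by apply: eq_map_poly => c /=; rewrite jc.
Qed.

Lemma ext1_0 : ext iota 1 0.
Proof.
exists (k^o : fieldExtType k), iota; split; last by exists 0; rewrite rmorph0.
  by rewrite dimvf.
by move=> c; rewrite /GRing.in_alg /= /GRing.scale /= mulr1.
Qed.

Lemma exact_point0 : exact_point 1 0 'X.
Proof.
split; rewrite ?monicX ?size_polyX //; first exact: ext1_0.
move=> h; rewrite -['X]subr0 dvdp_XsubCl /root ev_at0 fmorph_eq0.
by rewrite horner_coef0.
Qed.

(** * The field k_d as the values at a point of degree d, and its character sum *)

Section Exact.
Variables (d : nat) (x : K) (p : {poly k}) (px : exact_point d x p).

Definition exts := [seq ev w x | w <- polys k d].

Lemma ev_inj w w' : (size w <= d)%N -> (size w' <= d)%N ->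
  ev w x = ev w' x -> w = w'.
Proof.
case: px => d0 _ mp sp Hp sw sw' e; apply/eqP; rewrite -subr_eq0.
apply: contraT => n0.
have : p %| w - w' by rewrite -Hp evB e subrr.
move=> /(dvdp_leq n0); rewrite sp => H.
have := leq_trans H (size_polyD _ _); rewrite size_polyN leq_max.
by case/orP; rewrite ltnNge ?sw ?sw'.
Qed.

Lemma exts_uniq : uniq exts.
Proof.
rewrite map_inj_in_uniq ?polys_uniq // => w w'.
by rewrite !mem_polys; apply: ev_inj.
Qed.

Lemma size_exts : size exts = (q ^ d)%N.
Proof. by rewrite size_map size_polys. Qed.

(** The q^d listed values are distinct roots of X^(q^d) - X, whose degree leaves no room for a
    further root. *)
Lemma mem_extsF z : (z \in exts) = (z ^+ (q ^ d) == z).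
Proof.
have [d0 ex _ _ _] := px.
apply/idP/idP => [/mapP[w _ ->]|ez]; first by rewrite ext_fermat //; apply: ext_ev.
apply: contraT => nz.
pose P : {poly K} := 'X^(q ^ d) - 'X.
have q1 : (1 < q ^ d)%N by rewrite -(exp1n d) ltn_exp2r // finNzRing_gt1.
have sP : size P = (q ^ d).+1.
  by rewrite size_polyDl size_polyXn // size_polyN size_polyX.
have P0 : P != 0 by rewrite -size_poly_gt0 sP.
have /(max_poly_roots P0) : all (root P) (z :: exts).
  apply/allP => y; rewrite inE /root !hornerE subr_eq0.
  move=> /predU1P[-> //|/mapP[w _ ->]].
  by apply/eqP/ext_fermat/ext_ev.
by rewrite /= nz exts_uniq size_exts sP ltnn => /(_ isT).
Qed.

Lemma mem_exts z : (z \in exts) <-> ext iota d z.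
Proof.
have [d0 ex _ _ _] := px.
split=> [/mapP[w _ ->]|/ext_fermat e]; first exact: ext_ev.
by rewrite mem_extsF e.
Qed.

Lemma exts_affine a c z : a \in exts -> c \in exts -> z \in exts ->
  a + c * z \in exts.
Proof.
have [d0 ex _ _ _] := px.
move=> /mapP[wa _ ->] /mapP[wc _ ->] /mapP[w _ ->].
by rewrite -evM -evD; apply/mem_exts/ext_ev.
Qed.

Lemma exts0 : 0 \in exts.
Proof.
have [d0 ex _ _ _] := px.
by have /mem_exts := ext_ev 0 ex; rewrite ev0.
Qed.

Lemma exts_opp z : z \in exts -> - z \in exts.
Proof.
have [d0 ex _ _ _] := px.
have /mem_exts e1 := ext_ev (-1) ex.
move=> zx; have := exts_affine exts0 e1 zx.
by rewrite /ev rmorphN1 hornerN hornerC mulN1r add0r.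
Qed.

Lemma exts_inv z : z \in exts -> z^-1 \in exts.
Proof. by rewrite !mem_extsF exprVn => /eqP->. Qed.

Hypothesis q_odd : odd q.

Lemma two_neq0 : (2 : K) != 0.
Proof.
apply/negP => /eqP e; have ch : 2 \in [pchar k].
  by apply/andP; split=> //; rewrite -(fmorph_eq0 iota) rmorph_nat e.
(* In characteristic 2, q is a power of 2, and this is odd only when q = 1. *)
have := card_pprimeChar ch; rewrite -/q => eq; move: q_odd (finNzRing_gt1 k).
by rewrite eq oddX orbF => /eqP ->.
Qed.

Lemma sum_delta a : a \in exts -> \sum_(y <- exts) (y == a)%:R = 1 :> rat.
Proof.
move=> ax; rewrite (bigD1_seq a) ?exts_uniq //= eqxx big1 ?addr0 // => y.
by move=> /negPf->.
Qed.

(* Counting square roots gives 1 + chi, which avoids the group structure of the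
   squares and yields the vanishing of the character sum. *)
Lemma count_sqrt z : z \in exts ->
  \sum_(y <- exts) (y ^+ 2 == z)%:R = 1 + chi2 iota d z :> rat.
Proof.
move=> zx; rewrite /chi2; case: eqP => [->|/eqP z0].
  by rewrite addr0 -[RHS](sum_delta exts0); apply: eq_bigr => y _; rewrite sqrf_eq0.
case: asboolP => [[y0 /mem_exts y0x ez]|no].
  have y0N : y0 != - y0.
    rewrite -subr_eq0 opprK -mulr2n -mulr_natl mulf_neq0 ?two_neq0 //.
    by apply: contra_neq z0 => e; rewrite ez e expr0n.
  have <- := congr2 +%R (sum_delta y0x) (sum_delta (exts_opp y0x)).
  rewrite -big_split.
  apply: eq_bigr => y _; rewrite ez eqf_sqr /=.
  by case: eqP => [->|_]; rewrite ?(negPf y0N) ?addr0 ?add0r.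
rewrite subrr big1_seq // => y /andP[_ yx]; case: eqP => // e.
by case: no; exists y => //; apply/mem_exts.
Qed.

(** The pairs (y, z) with y^2 = z are counted twice: by y there are q^d of them, by z there are q^d
    plus the character sum. *)
Lemma sum_chi2 : \sum_(z <- exts) chi2 iota d z = 0.
Proof.
have : \sum_(z <- exts) \sum_(y <- exts) (y ^+ 2 == z)%:R
    = (size exts)%:R :> rat.
  rewrite exchange_big /= -sum1_size natr_sum; apply: eq_big_seq => y yx.
  under eq_bigr do rewrite eq_sym; apply: sum_delta.
  have := exts_affine _ yx yx; rewrite expr2 -[X in X \in _]add0r; apply.
  exact: exts0.
rewrite (eq_big_seq _ count_sqrt) big_split /= -sum1_size natr_sum.
by rewrite -[RHS]addr0 => /addrI.
Qed.

(** As [w] varies, [ev w x] runs once through k_d, and an affine map with nonzero slope, being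
    injective, permutes this finite set. *)
Lemma sum_chi2_affine a c : ext iota d a -> ext iota d c -> c != 0 ->
  \sum_(w <- polys k d) chi2 iota d (a + c * ev w x) = 0.
Proof.
move=> /mem_exts ax /mem_exts cx c0; rewrite -[RHS]sum_chi2.
rewrite -(big_map (fun w => a + c * ev w x) xpredT (chi2 iota d)).
apply: perm_big; have -> : [seq a + c * ev w x | w <- polys k d]
    = [seq a + c * z | z <- exts] by rewrite /exts -map_comp.
have un : uniq [seq a + c * z | z <- exts].
  by rewrite map_inj_uniq ?exts_uniq // => z z' /addrI /(mulfI c0).
apply: uniq_perm => //; first exact: exts_uniq.
have sub : {subset [seq a + c * z | z <- exts] <= exts}.
  by move=> _ /mapP[z zx ->]; apply: exts_affine.
by have [] := uniq_min_size un sub; rewrite ?size_map.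
Qed.
End Exact.

End Points.

(** * Minimal polynomials of a tuple in A(n) *)

Section Tuple.
Variables (k : finFieldType) (K : closedFieldType) (iota : {rmorphism k -> K}).
Implicit Types (x y z : K) (h p w : {poly k}) (d s : nat).
Local Notation q := #|k|.
Local Notation ev := (ev iota).

(** As q is a power of the characteristic, raising to the power q is additive; it also fixes the
    image of k. *)
Lemma ev_frob h z : ev h (z ^+ q) = ev h z ^+ q.
Proof.
have [c _ ch] := finPcharP k.
have chK : c \in [pchar K] by rewrite (fmorph_pchar iota).
have qc : c.-nat q.
  by rewrite -[q]/#|pPrimeCharType ch| card_pprimeChar pnatX pnat_id ?(pcharf_prime ch).
elim/poly_ind: h => [|h c0 IH]; first by 
  by rewrite !ev0 expr0n; case: q (finNzRing_gt1 k).
rewrite !evD !evM !evC !ev_X IH exprDn_pchar ?(eq_pnat _ (pcharf_eq chK)) //.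
by rewrite exprMn -rmorphXn expf_card.
Qed.

(** If p = b a, then x is a root of one of the factors, which p then divides. *)
Lemma exact_point_irr d x p : exact_point iota d x p -> irreducible_poly p.
Proof.
move=> [d0 _ mp sp Hp]; split; first by rewrite sp.
suff H (a : {poly k}) : size a != 1%N -> a %| p -> a %= p by exact: H.
move=> /eqP sa /dvdpP[b]; change (polynomial k) in b => eb.
have p0 := monic_neq0 mp.
have a0 : a != 0 by apply: contra_neq p0 => e; rewrite eb e mulr0.
have b0 : b != 0 by apply: contra_neq p0 => e; rewrite eb e mul0r.
have : ev p x == 0 by rewrite Hp.
rewrite eb evM mulf_eq0 !Hp => /orP[|pa].
  move=> /(dvdp_size_leq b0); rewrite eb size_polyM //.
  have := size_poly_gt0 a; rewrite a0.
  have := size_poly_gt0 b; rewrite b0.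
  lia.
by rewrite /eqp -eb pa eb dvdp_mull.
Qed.

(** The d conjugates y^(q^s), s < d, are distinct roots of p, which has degree d, so x is among
    them. *)
Lemma root_conjugate d x y p : exact_point iota d y p ->
  (forall s, y ^+ (q ^ s) = y -> (d %| s)%N) -> ev p x = 0 ->
  exists s, x = y ^+ (q ^ s).
Proof.
move=> [d0 ey mp sp Hp] Hy px.
pose rs := mkseq (fun s => y ^+ (q ^ s)) d.
have un : uniq rs.
  apply/mkseq_uniqP => s t.
  have H s' t' : (s' < d)%N -> (t' < d)%N ->
      y ^+ (q ^ s') = y ^+ (q ^ t') -> (s' <= t')%N -> s' = t'.
    (* Raising the equality of two conjugates to the power q^(d - s') returns y on one side, so d
       divides t' - s', which is smaller than d. *)
    move=> sd td e st; have /Hy : y ^+ (q ^ (t' + (d - s'))) = y.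
      rewrite expnD exprM -e -exprM -expnD subnKC; last exact: ltnW.
      exact: (ext_fermat ey).
    have -> : (t' + (d - s') = d + (t' - s'))%N by lia.
    rewrite dvdn_addr // => dv; apply/eqP; rewrite eqn_leq st /= -subn_eq0.
    apply: contraLR dv; rewrite -lt0n => ts; rewrite gtnNdvd //; lia.
  rewrite !inE => sd td e; case: (leqP s t) => st; first exact: H.
  by apply/esym/H => //; apply: ltnW.
case: (boolP (x \in rs)) => [/mapP[s _ ->]|nx]; first by exists s.
have P0 : map_poly iota p != 0 by rewrite map_poly_eq0 monic_neq0.
have /(max_poly_roots P0) : all (root (map_poly iota p)) (x :: rs).
  apply/allP => z; rewrite inE => /predU1P[->|/mapP[s _ ->]]; first exact/eqP.
  elim: s => [|s IH]; first by rewrite expr1 /root -/(ev p y) Hp.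
  rewrite expnSr exprM /root -/(ev p _) ev_frob expf_eq0.
  by rewrite [_ == 0]IH andbT; case: q (finNzRing_gt1 k).
by rewrite /= nx un size_mkseq size_map_poly sp ltnn => /(_ isT).
Qed.

(** This is all that is used below about membership in A(n). Two minimal polynomials that are not
    coprime would make two entries conjugate. Infinity is fixed by Frobenius, so s = 1 gives n_i = 1
    there and s = 0 shows that only one index can be infinite; taking p_i = 1 for it imposes no
    divisibility. *)
Lemma tuple_minpolys m (n : 'I_m -> nat) (alpha : {ffun 'I_m -> option K}) :
    (forall i, (0 < n i)%N) -> A iota n alpha ->
  exists p : 'I_m -> {poly k},
    [/\ forall i, if alpha i is Some x then exact_point iota (n i) x (p i)
                  else p i = 1 /\ n i = 1%N,
      forall i j, i != j -> coprimep (p i) (p j)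
    & forall i j, alpha i = None -> alpha j = None -> i = j].
Proof.
move=> n0 [Hext Hinj].
have Hmin i x : alpha i = Some x -> forall s, x ^+ (q ^ s) = x -> (n i %| s)%N.
  by move=> ax s e; have [] := Hinj i i s; rewrite // ax iter_frob e.
pose Q i (p : {poly k}) := if alpha i is Some x
  then exact_point iota (n i) x p else p = 1 /\ n i = 1%N.
have [p Hp] : exists p : 'I_m -> {poly k}, forall i, Q i (p i).
  suff /boolp.choice [p Hp] : forall i, exists p, Q i p by exists p.
  move=> i; rewrite /Q.
  have := Hext i; have := Hmin i; case ax: (alpha i) => [x|] Hx ex.
    have [p [mp sp Hp]] := ext_minpoly (n0 i) ex (Hx x erefl).
    by exists p.
  exists 1; split=> //; have [] := Hinj i i 1%N; first by rewrite ax.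
  by rewrite dvdn1 => /eqP.
exists p; split=> // [i j ij|i j ai aj]; last first.
  by have [] := Hinj i j 0%N => //=; rewrite ai aj.
have := Hp i; have := Hp j; rewrite /Q.
case ai: (alpha i) => [x|]; last by move=> _ [-> _]; rewrite coprime1p.
case aj: (alpha j) => [y|]; last by move=> [-> _]; rewrite coprimep1.
move=> py px; rewrite irreducible_poly_coprime; last exact: exact_point_irr px.
have [_ _ _ _ Hpx] := px; rewrite -Hpx; apply/negP => /eqP e.
have [s es] := root_conjugate py (Hmin _ _ aj) e.
have [|_ eji] := Hinj j i s; first by rewrite aj ai iter_frob es.
by rewrite eji eqxx in ij.
Qed.
End Tuple.

(** * Inclusion-exclusion *)

Section InclusionExclusion.
Variables (q m : nat) (n : 'I_m -> nat).
Local Notation deg S := (\sum_(t in S) n t)%N.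

(** The coefficient of t^j in the product of the 1 - t^(n i) over i in [T], divided by 1 - q t. *)
Definition excl_sum (T : pred 'I_m) (j : nat) : int :=
  \sum_(S : {set 'I_m} | (S \subset T) && (deg S <= j)%N)
    (-1) ^+ #|S| * q%:Z ^+ (j - deg S).

Lemma b_formulaE j : (forall i, 0 < n i)%N ->
  b_formula q n j = excl_sum predT j.
Proof.
move=> n0; rewrite /b_formula /excl_sum.
(* Each n_i is at least 1, so a set of degree at most j has at most j elements and [inord] below is
   faithful. *)
have sub (S : {set 'I_m}) : (#|S| <= deg S)%N.
  by rewrite -sum1_card; apply: leq_sum.
transitivity (\sum_(0 <= i < j.+1) (-1) ^+ i *
    \sum_(S : {set 'I_m} | (#|S| == i) && (deg S <= j)%N)
      q%:Z ^+ (j - deg S)).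
  rewrite [RHS]big_ltn // expr0 mul1r; congr (_ + _).
  rewrite (big_pred1 finset.set0) ?big_set0 ?subn0 // => S /=.
  by rewrite cards_eq0; case: eqP => // ->; rewrite big_set0.
rewrite big_mkord.
rewrite (partition_big (fun S : {set 'I_m} => inord #|S| : 'I_j.+1) xpredT) //=.
apply: eq_bigr => i _; rewrite big_distrr /=; apply: eq_big => S.
  rewrite subset_predT /= andbC; case: leqP => //= Sj.
  by rewrite -(inj_eq val_inj) /= inordK // ltnS (leq_trans (sub S)).
by case/andP => /eqP->.
Qed.

(** Adding i0 to a set that avoids it flips the sign and raises the degree by 1. For j = 0 no set
    containing i0 is small enough, hence the 0. *)
Lemma excl_sum_diff (i0 : 'I_m) j : n i0 = 1%N ->
  excl_sum predT j = excl_sum (predC1 i0) j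
    - (if j is j'.+1 then excl_sum (predC1 i0) j' else 0).
Proof.
move=> n1; rewrite /excl_sum (bigID (fun S : {set 'I_m} => i0 \in S)) /= addrC.
have subE (S : {set 'I_m}) : (S \subset predC1 i0) = (i0 \notin S).
  rewrite subset_disjoint disjoint_sym -disjoint1.
  by apply: eq_disjoint => i; rewrite !inE negbK.
congr (_ + _).
  by apply: eq_bigl => S; rewrite subset_predT subE andbC.
rewrite (reindex_onto (fun S => i0 |: S)%SET (fun S => S :\ i0)%SET) /=; last first.
  by move=> S /andP[_ iS]; rewrite finset.setD1K.
have condE (S : {set 'I_m}) : ((i0 |: S) :\ i0 == S)%SET = (i0 \notin S).
  by apply/eqP/idP => [<-|/setU1K //]; rewrite !inE eqxx.
under eq_bigl => S do rewrite subset_predT setU11 andbT condE.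
have degE (S : {set 'I_m}) : i0 \notin S -> deg (i0 |: S)%SET = (deg S).+1.
  by move=> iS; rewrite big_setU1 //= n1.
case: j => [|j].
  by rewrite oppr0 big1 // => S /andP[+ iS]; rewrite degE.
rewrite -sumrN; apply: eq_big => S.
  by rewrite subE andbC; case: (boolP (i0 \in S)) => //= iS; rewrite degE.
by case/andP=> _ iS; rewrite degE // cardsU1 iS exprS subSS mulN1r mulNr.
Qed.

(* In generating series: division of prod_i (1 - t^(n i)) / (1 - q t) by 1 - t
   removes the factor of i0. *)
Lemma excl_sum_telescope (i0 : 'I_m) j : n i0 = 1%N ->
  \sum_(0 <= i < j.+1) excl_sum predT i = excl_sum (predC1 i0) j.
Proof.
move=> n1; elim: j => [|j IH].
  by rewrite big_nat1 (excl_sum_diff 0 n1) subr0.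
by rewrite big_nat_recr //= IH (excl_sum_diff j.+1 n1) addrC subrK.
Qed.
End InclusionExclusion.

(** * Counting monic polynomials divisible by none of the given ones *)

Section Counting.
Variable k : finFieldType.
Local Notation q := #|k|.
Implicit Types (f h l w D : {poly k}).

Lemma monic_Xn_add w t : (size w <= t)%N ->
  'X^t + w \is monic /\ size ('X^t + w) = t.+1.
Proof.
move=> sw; split; last by rewrite size_polyDl size_polyXn.
by rewrite monicE lead_coefDl ?size_polyXn // lead_coefXn.
Qed.

Lemma size_monic_subXn f t : f \is monic -> size f = t.+1 ->
  (size (f - 'X^t)%R <= t)%N.
Proof.
move=> mf sf; apply/leq_sizeP => i; rewrite leq_eqVlt coefB coefXn.
case/predU1P => [<-|ti]; last by rewrite gtn_eqF // subr0 nth_default // sf.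
by move/monicP: mf; rewrite lead_coefE sf /= => ->; rewrite eqxx subrr.
Qed.

Lemma size_polyM_leq f h s t : (size f <= s)%N -> (size h <= t.+1)%N ->
  (size (f * h)%R <= s + t)%N.
Proof.
have pred_add a b : (a <= s -> b <= t.+1 -> (a + b).-1 <= s + t)%N by lia.
by move=> sf sh; apply: leq_trans (size_polyMleq f h) _; apply: pred_add.
Qed.

Lemma coef_monicM D f e t : D \is monic -> size D = e.+1 -> (size f <= t.+1)%N ->
  (D * f)`_(e + t) = f`_t.
Proof.
move=> mD sD sf; rewrite -[D](subrK 'X^e) mulrDl coefD nth_default ?add0r.
  by rewrite mulrC coefMXn ltnNge leq_addr /= addKn.
exact/size_polyM_leq/sf/size_monic_subXn.
Qed.

(** The cofactor is monic of degree j - e, that is, X^(j - e) plus an arbitrary polynomial of lower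
    degree. *)
Lemma count_monic_multiple D e j : D \is monic -> size D = e.+1 ->
  \sum_(l <- polys k j.+1 | [&& l \is monic, size l == j.+1 & D %| l]) 1
  = if (e <= j)%N then q%:Z ^+ (j - e) else 0.
Proof.
move=> mD sD; have D0 := monic_neq0 mD.
case: leqP => ej; last first.
  rewrite big_pred0 // => l; apply/negP => /and3P[ml /eqP sl].
  by move=> /(dvdp_size_leq (monic_neq0 ml)); rewrite sD sl ltnS leqNgt ej.
rewrite (@big_polys_reindex _ _ _ (j - e) _ predT
  (fun w => D * ('X^(j - e) + w)) (fun l => l %/ D - 'X^(j - e))).
- by rewrite big_const_seq count_predT size_polys iter_addr_0 natrX natz.
- move=> w sw _; have [mw szw] := monic_Xn_add sw.
  have sz : size (D * ('X^(j - e) + w)) = j.+1.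
    by rewrite size_polyM ?monic_neq0 // sD szw; lia.
  rewrite sz leqnn monicMl // mw eqxx dvdp_mulr //=; split=> //.
  by rewrite mulrC mulpK // addrC addKr.
- move=> l _ /and3P[ml /eqP sl dl]; have el := divpK dl.
  have l0 := monic_neq0 ml.
  have h0 : l %/ D != 0 by apply: contra_neq l0 => e0; rewrite -el e0 mul0r.
  have mh : l %/ D \is monic by rewrite -(monicMr _ mD) el.
  split=> //; last by rewrite addrC subrK mulrC.
  apply: size_monic_subXn => //.
  have sg (g : {poly k}) : g * D = l -> g != 0 -> size g = (j - e).+1.
    by move=> eg g0; move: sl; rewrite -eg size_polyM // sD; lia.
  exact: sg.
Qed.

Section Coprime.
Variables (m : nat) (n : 'I_m -> nat) (p : 'I_m -> {poly k}) (T : pred 'I_m).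
Hypotheses (p_monic : forall i, p i \is monic)
  (p_size : forall i, T i -> size (p i) = (n i).+1)
  (p_cop : forall i j, i != j -> coprimep (p i) (p j)).

Definition avoids l := [forall (i | T i), ~~ (p i %| l)].

Definition count_avoid j : int :=
  \sum_(l <- polys k j.+1 | [&& l \is monic, size l == j.+1 & avoids l]) 1.

Lemma prod_dvd (S : {set 'I_m}) l :
  (\prod_(i in S) p i %| l) = [forall (i | i \in S), p i %| l].
Proof.
have cop i (s : seq 'I_m) : i \notin s -> coprimep (p i) (\prod_(j <- s) p j).
  elim: s => [|j s IH]; first by rewrite big_nil coprimep1.
  by rewrite inE negb_or big_cons coprimepMr => /andP[ij /IH ->]; rewrite p_cop.
rewrite -big_enum.
have -> : [forall (i | i \in S), p i %| l] = all (fun i => p i %| l) (enum S).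
  apply/forallP/allP => H i; first by rewrite mem_enum => iS; apply: (implyP (H i)).
  by apply/implyP => iS; apply: H; rewrite mem_enum.
elim: (enum S) (enum_uniq S) => [|i s IH] /=; first by rewrite big_nil dvd1p.
by case/andP => ni us; rewrite big_cons Gauss_dvdp ?cop // IH.
Qed.

Lemma size_prod_monic (Q : pred 'I_m) (F : 'I_m -> {poly k}) :
  (forall i, F i \is monic) ->
  size (\prod_(i | Q i) F i) = (\sum_(i | Q i) (size (F i)).-1).+1.
Proof.
move=> mF; suff [] : size (\prod_(i | Q i) F i) = (\sum_(i | Q i) (size (F i)).-1).+1
  /\ \prod_(i | Q i) F i \is monic by [].
elim/big_rec2: _ => [|i a f _ [sf mf]]; first by rewrite size_poly1 monic1.
rewrite monicMl // size_polyM ?monic_neq0 // sf; split=> //.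
have := size_poly_gt0 (F i); rewrite monic_neq0 //; lia.
Qed.

(** The indicator of [avoids] is the product over i in [T] of 1 - [p_i divides l]. Expanding it
    gives a signed sum over subsets S, and by coprimality all p_i with i in S divide l exactly when
    their product does. *)
Lemma count_avoidE j : count_avoid j = excl_sum q n T j.
Proof.
rewrite /count_avoid /excl_sum.
transitivity (\sum_(l <- polys k j.+1 | (l \is monic) && (size l == j.+1))
   \sum_(S : {set 'I_m} | S \subset T)
     (-1) ^+ #|S| * ((\prod_(i in S) p i %| l)%R%:R : int)).
  under eq_bigl => l do rewrite andbA.
  rewrite big_mkcondr /=; apply: eq_bigr => l _.
  have -> : (if avoids l then 1 else 0 : int)
      = \prod_i (- (T i && (p i %| l))%R%:R + 1).
    rewrite /avoids; case: forallP => [H|/forallP].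
      rewrite big1 // => i _; have := H i.
      by case: (T i) => //= /negPf->; rewrite oppr0 add0r.
    rewrite negb_forall => /existsP[i]; rewrite negb_imply negbK => /andP[Ti pi].
    by rewrite (bigD1 i) //= Ti pi addNr mul0r.
  rewrite bigA_distr big_mkcond [RHS]big_mkcond; apply: eq_bigr => S _ /=.
  rewrite -big_mkcond /= prodrN.
  (* The expansion runs over all S; one not inside [T] has a zero factor. *)
  case: ifP => [/fintype.subsetP ST|/negbT/fintype.subsetPn[i iS iT]].
    congr (_ * _); rewrite prod_dvd; case: forallP => [H|/forallP].
      rewrite big1 // => i iS; have := H i; rewrite iS /= => ->.
      by have -> : T i by apply: ST.
    rewrite negb_forall => /existsP[i]; rewrite negb_imply => /andP[iS /negPf npi].
    by rewrite (bigD1 i) //= npi andbF mul0r.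
  rewrite (bigD1 i) //=; have -> : T i = false by apply/negbTE.
  by rewrite mul0r mulr0.
rewrite exchange_big /= big_mkcondr; apply: eq_bigr => S /fintype.subsetP ST.
rewrite -big_distrr /=.
have mD : \prod_(i in S) p i \is monic by apply: monic_prod.
have sD : size (\prod_(i in S) p i) = (\sum_(i in S) n i).+1.
  rewrite size_prod_monic //; congr _.+1; apply: eq_bigr => i iS.
  by rewrite p_size //; apply: ST.
have := count_monic_multiple j mD sD.
move=> E.
have -> : \sum_(l <- polys k j.+1 | (l \is monic) && (size l == j.+1))
   ((\prod_(i in S) p i %| l)%R%:R : int)
   = \sum_(l <- polys k j.+1 | [&& l \is monic, size l == j.+1
       & \prod_(i in S) p i %| l]) 1.
  under [RHS]eq_bigl => l do rewrite andbA.
  by rewrite [RHS]big_mkcondr /=; apply: eq_bigr => l _; case: ifP.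
by rewrite E; case: ifP; rewrite ?mulr0.
Qed.
End Coprime.
End Counting.

(** * Sums at a fixed tuple *)

Section Pointwise.
Variables (k : finFieldType) (K : closedFieldType) (iota : {rmorphism k -> K}).
Implicit Types (x y z : K) (h f l w : {poly k}) (d s : nat).
Local Notation q := #|k|.
Local Notation ev := (ev iota).

Lemma chi2_0 d : chi2 iota d 0 = 0.
Proof. by rewrite /chi2 eqxx. Qed.

Lemma chi2_sqr d z : chi2 iota d z ^+ 2 = (z != 0)%:R.
Proof.
rewrite /chi2; case: eqP => _; first by rewrite expr0n.
by case: asboolP; rewrite ?sqrrN expr1n.
Qed.

(** Multiplication by y, invertible in k_d, carries square roots of z to square roots of y^2 z. *)
Lemma chi2_mul_sqr d x p y z : exact_point iota d x p -> ext iota d y -> y != 0 ->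
  chi2 iota d (y ^+ 2 * z) = chi2 iota d z.
Proof.
move=> px /(mem_exts px) yx y0; rewrite /chi2 mulf_eq0 expf_eq0 (negPf y0) /=.
have mul u v : u \in exts iota d x -> v \in exts iota d x -> ext iota d (u * v).
  move=> ux vx; apply/(mem_exts px).
  by rewrite -[_ * _]add0r (exts_affine px) // (exts0 px).
case: eqP => // _; congr (if _ then _ else _); apply/asboolP/asboolP.
  move=> [u /(mem_exts px) ux e]; exists (u * y^-1).
    by apply: mul => //; apply: exts_inv px _ _.
  by rewrite exprMn -e exprVn mulrAC mulfV ?mul1r // expf_neq0.
by move=> [u /(mem_exts px) ux ->]; exists (y * u); rewrite ?exprMn //; apply: mul.
Qed.

Variables (m : nat) (n r : 'I_m -> nat) (alpha : {ffun 'I_m -> option K})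
  (p : 'I_m -> {poly k}).
Hypotheses
  (alpha_p : forall i, if alpha i is Some x then exact_point iota (n i) x (p i)
                       else p i = 1 /\ n i = 1%N)
  (p_cop : forall i j, i != j -> coprimep (p i) (p j))
  (alpha_oo : forall i j, alpha i = None -> alpha j = None -> i = j).

Local Notation T := [pred i | alpha i != None].

Lemma p_monic i : p i \is monic.
Proof.
have := alpha_p i; case: (alpha i) => [x []//|[-> _]]; exact: monic1.
Qed.

Lemma p_size i : T i -> size (p i) = (n i).+1.
Proof. by have := alpha_p i; rewrite /=; case: (alpha i) => [x []|]. Qed.

Lemma p_size_oo i : ~~ T i -> (size (p i)).-1 = 0%N.
Proof.
have := alpha_p i; rewrite /=; case: (alpha i) => [//|[-> _] _].
by rewrite size_poly1.
Qed.

Lemma n_gt0 i : (0 < n i)%N.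
Proof. by have := alpha_p i; case: (alpha i) => [x []|[_ ->]]. Qed.

(* G stands for g + 1, so that 2 * g + 2 = 2 * G without truncation *)
Definition evp (G : nat) h (a : option K) : K :=
  if a is Some x then ev h x else iota h`_(2 * G).

Lemma evpD G h h' a : evp G (h + h') a = evp G h a + evp G h' a.
Proof. by case: a => [x|] /=; rewrite ?evD // coefD rmorphD. Qed.

(* The values of polynomials at infinity are those of constants at 0, so that
   (0, 'X) can play the role of an exact point of degree 1 there. *)
Definition pt i : K := if alpha i is Some x then x else 0.
Definition minp i : {poly k} := if alpha i is Some x then p i else 'X.

Lemma exact_pt i : exact_point iota (n i) (pt i) (minp i).
Proof.
rewrite /pt /minp; have := alpha_p i; case: (alpha i) => [x //|[_ ->]].
exact: exact_point0.
Qed.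

Lemma ext_evp G h i : ext iota (n i) (evp G h (alpha i)).
Proof.
have := alpha_p i; case: (alpha i) => [x [_ ex _ _ _]|[_ ->]] /=.
  exact: ext_ev.
by rewrite -(evC iota _ 0); apply/ext_ev/ext1_0.
Qed.

Definition Phi G h : rat := \prod_i chi2 iota (n i) (evp G h (alpha i)) ^+ r i.

Lemma p_dvdE i x h : alpha i = Some x -> (p i %| h) = (ev h x == 0).
Proof. by move=> e; have := alpha_p i; rewrite e => -[_ _ _ _ ->]. Qed.

Lemma avoidsP h : reflect (forall i x, alpha i = Some x -> ev h x <> 0)
  (avoids p T h).
Proof.
apply: (iffP forallP) => [H i x e|H i].
  by have := H i; rewrite /= e /= (p_dvdE _ e) => /eqP.
apply/implyP; rewrite /=; case e: (alpha i) => [x|//] _.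
by rewrite (p_dvdE _ e); apply/eqP/H/e.
Qed.

(** At a finite point the factor l^2 contributes a square, nonzero unless l vanishes there. At
    infinity the monic l^2 of degree 2j moves the coefficient at 2(G - j) to 2G. *)
Lemma Phi_mul_sqr G j l f : (j <= G)%N -> l \is monic -> size l = j.+1 ->
    (forall i, 0 < r i)%N -> (size f <= (2 * (G - j)).+1)%N ->
  Phi G (l ^+ 2 * f) = if avoids p T l then Phi (G - j) f else 0.
Proof.
move=> jG ml sl r0 sf.
have coef : (l ^+ 2 * f)`_(2 * G) = f`_(2 * (G - j)).
  have m2 : l ^+ 2 \is monic by rewrite monic_exp.
  have s2 : size (l ^+ 2) = (2 * j).+1.
    by rewrite expr2 size_polyM ?monic_neq0 // sl; lia.
  by rewrite -(coef_monicM m2 s2 sf); congr _`_ _; lia.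
case: avoidsP => [av|/existsNP[i /existsNP[x /not_implyP[e /contrapT lx]]]].
  apply: eq_bigr => i _; congr (_ ^+ _).
  case e: (alpha i) => [x|] /=; last by rewrite coef.
  rewrite evM evX (chi2_mul_sqr _ (exact_pt i)) //.
    by have := ext_evp G l i; rewrite e.
  by apply/eqP/av/e.
(* A zero of [l] kills the product because [r i] is positive; a zeroth power of 0 would be 1. *)
rewrite /Phi (bigD1 i) //= e /= evM evX lx expr0n mul0r chi2_0 expr0n.
by rewrite eqn0Ngt r0 mul0r.
Qed.

(* SQ G is membership in P_{G-1} *)
Definition SQ G f := `[< square_free f >] && (2 * G <= size f <= (2 * G).+1)%N.
Definition U G : rat := \sum_(f <- polys k (2 * G).+1 | SQ G f) Phi G f.
Local Notation c := (count_avoid p T).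
Hypothesis r_gt0 : forall i, (0 < r i)%N.

(** Dividing by l^2 lowers the degree by 2j, which carries the degrees 2G - 1 and 2G to 2(G - j) - 1
    and 2(G - j). *)
Lemma sum_sqr_multiples G j l : (j <= G)%N -> l \is monic -> size l = j.+1 ->
  \sum_(h <- polys k (2 * G).+1 | ((2 * G <= size h)%N && (h != 0)) &&
     [&& l \is monic, l ^+ 2 %| h & `[< square_free (h %/ l ^+ 2) >]]) Phi G h
  = if avoids p T l then U (G - j) else 0.
Proof.
move=> jG ml sl; have l0 := monic_neq0 ml.
have s2 : size (l ^+ 2) = (2 * j).+1 by rewrite expr2 size_polyM // sl; lia.
have l20 : l ^+ 2 != 0 by rewrite expf_neq0.
rewrite (@big_polys_reindex _ _ _ (2 * (G - j)).+1 _ (SQ (G - j))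
  (fun f => l ^+ 2 * f) (fun h => h %/ l ^+ 2)).
- rewrite /U; case: ifP => av; last first.
    rewrite big1 // => f /and3P[_ _ sf].
    by rewrite (Phi_mul_sqr jG ml sl r_gt0 sf) av.
  apply: eq_bigr => f /and3P[_ _ sf].
  by rewrite (Phi_mul_sqr jG ml sl r_gt0 sf) av.
- move=> f sf /and3P[/asboolP sqf s1 _].
  have f0 : f != 0.
    apply/eqP => f0; have := sqf 'X; rewrite f0 dvdp0 size_polyX.
    by move=> /(_ isT).
  have e : (l ^+ 2 * f) %/ l ^+ 2 = f by rewrite mulKp.
  rewrite e size_polyM // s2 ml mulf_neq0 // dvdp_mulr // asboolT //.
  split=> //; rewrite ?andbT; lia.
- move=> h sh /andP[/andP[s1 h0] /and3P[_ dv sq]].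
  have e : l ^+ 2 * (h %/ l ^+ 2) = h by rewrite mulrC divpK.
  have sg (g : {poly k}) : l ^+ 2 * g = h ->
      (2 * (G - j) <= size g <= (2 * (G - j)).+1)%N.
    move=> eg; have g0 : g != 0 by apply: contra_neq h0 => g0; rewrite -eg g0 mulr0.
    move: s1 sh (size_poly_gt0 g); rewrite -eg size_polyM // s2 g0; lia.
  by have /andP[? ?] := sg _ e; split=> //; apply/and3P; split.
Qed.

(** Each h is sorted by its unique monic square part l, whose degree is at most G since l^2 divides
    h. The condition [h != 0] removes the zero polynomial, which the size bound admits when G =
    0. *)
Lemma sum_sqfree_decomp G :
  \sum_(h <- polys k (2 * G).+1 | (2 * G <= size h)%N && (h != 0)) Phi G h
  = \sum_(0 <= j < G.+1) (c j)%:~R * U (G - j).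
Proof.
pose W h l := [&& l \is monic, l ^+ 2 %| h & `[< square_free (h %/ l ^+ 2) >]].
transitivity (\sum_(h <- polys k (2 * G).+1 | (2 * G <= size h)%N && (h != 0))
    \sum_(l <- polys k G.+1 | W h l) Phi G h).
  rewrite big_seq_cond [RHS]big_seq_cond; apply: eq_bigr => h.
  rewrite mem_polys => /and3P[sh _ h0].
  have [l0 [ml0 dl0 sl0]] := sqfree_ex h0.
  have l0in : l0 \in polys k G.+1.
    have := dvdp_size_leq h0 dl0; rewrite mem_polys.
    by rewrite expr2 size_polyM ?monic_neq0 //; lia.
  rewrite big_mkcond (bigD1_seq l0) ?polys_uniq //=.
  rewrite /W ml0 dl0 asboolT //= big1 ?addr0 // => l ll0.
  case: ifP => // /and3P[ml dl /asboolP sl]; move: ll0.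
  by rewrite (sqfree_uniq h0 ml ml0) ?eqxx.
rewrite (exchange_big_dep (fun l => l \is monic)) /=; last by move=> h l _ /and3P[].
rewrite sum_by_size; last by rewrite monicE lead_coef0 eq_sym oner_eq0.
apply: eq_big_nat => j /andP[_ jG].
rewrite /count_avoid rmorph_sum mulr_suml /=.
under [RHS]eq_bigl => l do rewrite andbA.
rewrite [RHS]big_mkcondr; apply: eq_bigr => l /andP[ml /eqP sl].
by rewrite (@sum_sqr_multiples G j l jG ml sl) mul1r.
Qed.

Definition hatb j : int := \sum_(0 <= i < j.+1) excl_sum q n predT i.

Lemma hatb_finite j : (forall i, T i) -> hatb j = \sum_(0 <= i < j.+1) c i.
Proof.
move=> Tall; apply: eq_big_nat => i _; rewrite (count_avoidE p_monic p_size p_cop).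
apply: eq_bigl => S; rewrite subset_predT.
have -> // : S \subset T by apply/fintype.subsetP => x _; apply: Tall.
Qed.

(** Here n_i0 = 1, so the partial sum drops the factor of i0; by [alpha_oo] the remaining indices
    are exactly those of the finite points. *)
Lemma hatb_oo i0 j : alpha i0 = None -> hatb j = c j.
Proof.
move=> a0; have n0 : n i0 = 1%N by have := alpha_p i0; rewrite a0 => -[].
rewrite /hatb (excl_sum_telescope _ _ n0) (count_avoidE p_monic p_size p_cop).
apply: eq_bigl => S; congr (_ && _); apply: eq_subset_r => i.
rewrite !inE; apply/idP/idP; first by apply: contra_neq => a; apply: alpha_oo.
by apply: contra_neq => ->.
Qed.

Lemma Phi_eq0 G h i : evp G h (alpha i) = 0 -> Phi G h = 0.
Proof.
move=> e; rewrite /Phi (bigD1 i) //= e chi2_0 expr0n eqn0Ngt r_gt0.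
by rewrite mul0r.
Qed.

Lemma sum_hatb_oo i0 G : alpha i0 = None ->
  \sum_(0 <= j < G.+1) (hatb j)%:~R * U (G - j)
  = \sum_(h <- polys k (2 * G).+1) Phi G h.
Proof.
move=> a0; under eq_bigr do rewrite (hatb_oo _ a0).
rewrite -sum_sqfree_decomp big_mkcond; apply: eq_bigr => h _.
(* The polynomials left out have coefficient 0 at X^(2G), so their character at infinity
   vanishes. *)
case: ifP => // H; apply/esym/(Phi_eq0 (i := i0)); rewrite a0 /=.
case: (h =P 0) H => [->|_]; first by rewrite coef0 rmorph0.
by rewrite andbT => /negbT; rewrite -ltnNge => sh; rewrite nth_default ?rmorph0 // ltnW.
Qed.

Lemma Phi_finite G G' h : (forall i, T i) -> Phi G h = Phi G' h.
Proof.
move=> Tall; apply: eq_bigr => i _; have := Tall i.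
by rewrite /=; case: (alpha i).
Qed.

Lemma Phi0 G : (0 < m)%N -> Phi G 0 = 0.
Proof.
move=> m0; apply: (Phi_eq0 (i := Ordinal m0)).
by case: (alpha _) => [x|] /=; rewrite ?ev0 // coef0 rmorph0.
Qed.

(** Induction on G. The step adds the sum weighted by c_j, which accounts for the degrees 2G + 1 and
    2G + 2; the lower degrees come from the induction hypothesis, as [Phi] ignores G when all points
    are finite. *)
Lemma sum_hatb_finite G : (0 < m)%N -> (forall i, T i) ->
  \sum_(0 <= j < G.+1) (hatb j)%:~R * U (G - j)
  = \sum_(h <- polys k (2 * G).+1) Phi G h.
Proof.
move=> m0 Tall; elim: G => [|G IH].
  have := sum_sqfree_decomp 0; rewrite !big_nat1 hatb_finite // big_nat1 => <-.
  rewrite big_mkcond; apply: eq_bigr => h _ /=.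
  by case: eqP => // ->; rewrite Phi0.
transitivity (\sum_(0 <= j < G.+1) (hatb j)%:~R * U (G - j)
   + \sum_(0 <= j < G.+2) (c j)%:~R * U (G.+1 - j)).
  rewrite big_nat_recl // [X in _ = _ + X]big_nat_recl // addrCA -big_split /=.
  rewrite hatb_finite // big_nat1; congr (_ + _); apply: eq_big_nat => j _.
  by rewrite !hatb_finite // subSS -mulrDl -rmorphD /= [in LHS]big_nat_recr.
rewrite IH -sum_sqfree_decomp.
rewrite [RHS](bigID (fun h => (size h <= (2 * G).+1)%N)) /=; congr (_ + _).
  rewrite (@sum_polys_leq _ _ (2 * G.+1).+1 (2 * G).+1).
    rewrite big_seq_cond [LHS]big_seq_cond; apply: eq_big => h.
      by rewrite mem_polys andbT andbb.
    by move=> _; apply: Phi_finite.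
  by move=> h sh; rewrite sh andbT (leq_trans sh) //; lia.
apply: eq_bigl => h; rewrite -ltnNge.
case: (h =P 0) => [->|_]; first by rewrite size_poly0 andbF.
by rewrite andbT mulnS.
Qed.

Lemma sum_hatb G : (0 < m)%N ->
  \sum_(0 <= j < G.+1) (hatb j)%:~R * U (G - j)
  = \sum_(h <- polys k (2 * G).+1) Phi G h.
Proof.
move=> m0; case: (boolP [forall i, T i]) => [/forallP|].
  exact: sum_hatb_finite.
by rewrite negb_forall => /existsP[i /negPn/eqP]; apply: sum_hatb_oo.
Qed.

(** Sorting by leading coefficient gives q - 1 classes, each a scaling of the monic one. *)
Lemma count_scaled j :
  \sum_(h <- polys k j.+1 | avoids p T h && (size h == j.+1)) 1
  = (q%:Z - 1) * c j.
Proof.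
have neq : (q%:Z - 1) = \sum_(a : k | a != 0) 1.
  rewrite sumr_const cardC1 natz -subn1 -subzn //; exact: ltnW (finNzRing_gt1 k).
rewrite neq mulr_suml.
rewrite (partition_big lead_coef (fun a => a != 0)) /=; last first.
  by move=> h /andP[_ /eqP sh]; rewrite lead_coef_eq0 -size_poly_gt0 sh.
apply: eq_bigr => a a0; rewrite mul1r /count_avoid.
have avZ b h : b != 0 -> avoids p T (b *: h) = avoids p T h.
  by move=> b0; apply: eq_forallb => i; rewrite dvdpZr.
rewrite (@big_polys_reindex _ _ _ j.+1 _
  (fun l => [&& l \is monic, size l == j.+1 & avoids p T l])
  (fun l => a *: l) (fun h => a^-1 *: h)) //.
- move=> l sl /and3P[ml /eqP szl av].
  rewrite size_scale // avZ // av szl eqxx lead_coefZ (monicP ml) mulr1 eqxx.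
  by rewrite scalerA mulVf // scale1r.
- move=> h sh /andP[/andP[av /eqP szh] /eqP lh].
  rewrite size_scale ?invr_neq0 // avZ ?invr_neq0 // av szh eqxx monicE.
  by rewrite lead_coefZ lh mulVf // eqxx scalerA mulfV // scale1r.
Qed.

Lemma Phi_sqr G h : (forall i, r i = 2%N) ->
  Phi G h = (avoids p T h && [forall i, (alpha i == None) ==> (h`_(2 * G) != 0)])%:R.
Proof.
move=> r2; have -> : Phi G h = \prod_i (evp G h (alpha i) != 0)%:R.
  by apply: eq_bigr => i _; rewrite r2 chi2_sqr.
have -> : avoids p T h && [forall i, (alpha i == None) ==> (h`_(2 * G) != 0)]
    = [forall i, evp G h (alpha i) != 0].
  apply/andP/forallP => [[/avoidsP av /forallP oo] i|H].
    have := oo i; case e: (alpha i) => [x|] /=; first by move=> _; apply/eqP/av/e.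
    by rewrite fmorph_eq0.
  split; first by apply/avoidsP => i x e; have := H i; rewrite e => /eqP.
  by apply/forallP => i; have := H i; case: (alpha i) => //=; rewrite fmorph_eq0.
case: forallP => [H|/forallP]; first by rewrite big1 // => i _; rewrite H.
rewrite negb_forall => /existsP[i /negPn/eqP e].
by rewrite (bigD1 i) //= e eqxx mul0r.
Qed.

Lemma avoids_neq0 h : (exists i, T i) -> avoids p T h -> h != 0.
Proof.
move=> [i Ti] /forallP/(_ i); rewrite Ti /=; apply: contraNneq => ->.
exact: dvdp0.
Qed.

(** [Phi] is now an indicator. With all points finite, the avoiding h are counted degree by degree;
    with a point at infinity, only degree exactly 2G survives. *)
Lemma sum_Phi_sqr G : (0 < m)%N -> (forall i, r i = 2%N) ->
  \sum_(h <- polys k (2 * G).+1) Phi G h = (q%:R - 1) * (hatb (2 * G))%:~R.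
Proof.
move=> m0 r2; under eq_bigr do rewrite (Phi_sqr _ _ r2).
have qE : q%:R - 1 = (q%:Z - 1)%:~R :> rat by rewrite rmorphB.
case: (boolP [forall i, T i]) => [/forallP Tall|].
  rewrite hatb_finite // qE -rmorphM mulr_sumr.
  rewrite (eq_bigr _ (fun j _ => esym (count_scaled j))).
  rewrite -sum_by_size; last first.
    by apply: contraT => /negPn /avoids_neq0; rewrite eqxx; apply; exists (Ordinal m0).
  rewrite rmorph_sum [RHS]big_mkcond; apply: eq_bigr => h _.
  have -> : [forall i, (alpha i == None) ==> (h`_(2 * G) != 0)].
    by apply/forallP => i; have := Tall i; rewrite /= => /negPf->.
  by rewrite andbT; case: avoids.
rewrite negb_forall => /existsP[i /negPn/eqP ai].
rewrite (hatb_oo _ ai) qE -rmorphM -count_scaled rmorph_sum [RHS]big_mkcond.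
rewrite big_seq [RHS]big_seq; apply: eq_bigr => h; rewrite mem_polys => sh /=.
have -> : [forall i, (alpha i == None) ==> (h`_(2 * G) != 0)] = (size h == (2 * G).+1).
  apply/forallP/eqP => [/(_ i)|szh j].
    rewrite ai eqxx /= => c0; apply/eqP; rewrite eqn_leq sh ltnNge.
    by apply: contra c0 => /leq_sizeP ->.
  apply/implyP => _; have -> : h`_(2 * G) = lead_coef h by rewrite lead_coefE szh.
  by rewrite lead_coef_eq0 -size_poly_gt0 szh.
by case: (_ && _).
Qed.

(** M is the product of the other minimal polynomials, so it vanishes at the other finite points,
    and c0 is its value at [alpha i0], nonzero by coprimality. *)
Lemma shift_poly G i0 : (\sum_i n i <= (2 * G).+1)%N ->
  exists M c0, [/\ c0 != 0, ext iota (n i0) c0 &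
    forall w, (size w <= n i0)%N ->
      [/\ (size (M * w)%R <= (2 * G).+1)%N,
          evp G (M * w) (alpha i0) = c0 * ev w (pt i0)
        & forall i, i != i0 -> evp G (M * w) (alpha i) = 0]].
Proof.
rewrite (bigD1 i0) //= => nG.
pose N := \prod_(i | i != i0) p i.
pose e := (\sum_(i | i != i0) (size (p i)).-1)%N.
have mN : N \is monic by apply: monic_prod => i _; apply: p_monic.
have sN : size N = e.+1 by apply: size_prod_monic; apply: p_monic.
have le_n i : ((size (p i)).-1 <= n i)%N.
  case: (boolP (T i)) => Ti; first by rewrite p_size.
  by rewrite p_size_oo.
have le_e : (e <= \sum_(i | i != i0) n i)%N by apply: leq_sum => i _; apply: le_n.
have dvN i f : i != i0 -> p i %| N * f.
  by move=> ii; rewrite /N (bigD1 i) //= -mulrA dvdp_mulr.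
have szM (f : {poly k}) t w : size f = t.+1 -> (size w <= n i0)%N ->
    (size (f * w)%R <= n i0 + t)%N.
  by move=> sf sw; rewrite mulrC size_polyM_leq // sf.
case e0: (alpha i0) => [x|].
  have px : exact_point iota (n i0) x (p i0) by have := alpha_p i0; rewrite e0.
  have ex : ext iota (n i0) x by case: px.
  exists N, (ev N x); split; first 2 last.
  - move=> w sw; split.
    + by apply: leq_trans (szM _ _ _ sN sw) (leq_trans _ nG); rewrite leq_add2l.
    + by rewrite /= evM /pt e0.
    + move=> i ii; case ei: (alpha i) => [y|] /=.
        by apply/eqP; rewrite -(p_dvdE _ ei) dvN.
      rewrite nth_default ?rmorph0 //.
      (* An infinite entry has n_i = 1 but p_i = 1 of degree 0. This saves one degree, so the
         coefficient of M w at 2G vanishes. *)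
      have ni : n i = 1%N by have := alpha_p i; rewrite ei => -[].
      have e1 : (e < \sum_(i | i != i0) n i)%N.
        have pi : (size (p i)).-1 = 0%N by apply: p_size_oo; rewrite /= ei.
        rewrite /e (bigD1 i) //= [ltnRHS](bigD1 i) //= ni pi add0n add1n ltnS.
        by apply: leq_sum => j _; apply: le_n.
      apply: leq_trans (szM _ _ _ sN sw) _.
      by rewrite -ltnS; apply: leq_trans nG; rewrite -addnS leq_add2l.
  - rewrite ev_prod; apply/prodf_neq0 => i ii.
    have [_ _ _ _ H] := px; rewrite H.
    by rewrite -irreducible_poly_coprime ?p_cop 1?eq_sym //; apply: exact_point_irr px.
  - exact: ext_ev.
have n1 : n i0 = 1%N by have := alpha_p i0; rewrite e0 => -[].
have eG : (e <= 2 * G)%N by rewrite -ltnS; apply: leq_trans nG; rewrite n1 add1n ltnS.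
(* The power of X brings M to degree exactly 2G; as n_i0 = 1, w is constant and is itself the
   coefficient of M w at 2G. *)
pose M := N * 'X^(2 * G - e).
have mM : M \is monic by rewrite monicMl // monicXn.
have sM : size M = (2 * G).+1.
  by rewrite size_polyM ?monic_neq0 ?monicXn // size_polyXn sN; lia.
exists M, 1; rewrite oner_neq0 n1; split=> //.
  by rewrite -(rmorph1 iota) -(evC iota _ 0); apply/ext_ev/ext1_0.
move=> w sw; split.
- by rewrite -n1 in sw; apply: leq_trans (szM _ _ _ sM sw) _; rewrite n1.
- rewrite /= -[(2 * G)%N]addn0 coef_monicM //.
  by rewrite mul1r /pt e0 ev_at0.
- move=> i ii; case ei: (alpha i) => [y|] /=.
    by apply/eqP; rewrite -(p_dvdE _ ei) -mulrA dvN.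
  by move: ii; rewrite (alpha_oo ei e0) eqxx.
Qed.

(** The sum is invariant under each shift of h by M w. Summing over w multiplies it by q^(n_i0); yet
    for fixed h only the factor at i0 depends on w, and it sums to 0. *)
Lemma sum_Phi_odd G i0 : odd q -> r i0 = 1%N -> (\sum_i n i <= (2 * G).+1)%N ->
  \sum_(h <- polys k (2 * G).+1) Phi G h = 0.
Proof.
move=> q_odd r1 nG; have [M [c0 [c00 ec0 HM]]] := shift_poly i0 nG.
have shift w : w \in polys k (n i0) ->
    \sum_(h <- polys k (2 * G).+1) Phi G h
    = \sum_(h <- polys k (2 * G).+1) Phi G (h + M * w).
  rewrite mem_polys => /HM[sM _ _].
  apply: (@big_polys_reindex _ _ _ _ predT predT _ (fun h => h - M * w)) => h sh _.
    by split; rewrite ?addrK // (leq_trans (size_polyD _ _)) // geq_max sh.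
  by split; rewrite ?subrK // (leq_trans (size_polyD _ _)) // geq_max sh size_polyN.
have : \sum_(w <- polys k (n i0)) \sum_(h <- polys k (2 * G).+1) Phi G (h + M * w) = 0.
  rewrite exchange_big /= big1 // => h _.
  transitivity (\sum_(w <- polys k (n i0))
      (\prod_(i | i != i0) chi2 iota (n i) (evp G h (alpha i)) ^+ r i)
      * chi2 iota (n i0) (evp G h (alpha i0) + c0 * ev w (pt i0))).
    rewrite big_seq [RHS]big_seq; apply: eq_bigr => w.
    rewrite mem_polys => /HM[_ e0 ei].
    rewrite /Phi (bigD1 i0) //= r1 expr1 mulrC evpD e0; congr (_ * _).
    by apply: eq_bigr => i ii; rewrite evpD ei // addr0.
  rewrite -mulr_sumr (sum_chi2_affine (exact_pt i0)) ?mulr0 //.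
  exact: ext_evp.
rewrite -(eq_big_seq _ shift) big_const_seq count_predT size_polys iter_addr_0.
move=> /eqP; rewrite mulrn_eq0 expn_eq0 => /orP[/andP[q0 _]|/eqP //].
by move: (finNzRing_gt1 k); rewrite (eqP q0).
Qed.

End Pointwise.

(** * Sums over A(n) *)

Section Global.
Variables (k : finFieldType) (K : closedFieldType) (iota : {rmorphism k -> K}).
Variables (m : nat) (n : 'I_m -> nat).
Hypothesis n_gt0 : forall i, (0 < n i)%N.
Implicit Types (alpha : {ffun 'I_m -> option K}) (r : 'I_m -> nat).

(** Both branches of [b] agree with inclusion-exclusion over all indices: a tuple in A'(n) has no
    infinite entry, so [T] is everything. *)
Lemma bE j : b iota n j = excl_sum #|k| n predT j.
Proof.
rewrite /b; case: asboolP => [[alpha0 H0]|_]; last exact: b_formulaE.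
have [HA Hfin] := xgetI [ffun=> None] H0.
set alpha := xget _ _ in HA Hfin *.
have [p [Hp Hcop _]] := tuple_minpolys n_gt0 HA.
have -> : excl_sum #|k| n predT j = excl_sum #|k| n [pred i | alpha i != None] j.
  apply: eq_bigl => S; congr (_ && _).
  by apply: eq_subset_r => i; rewrite !inE; apply/esym/eqP/Hfin.
rewrite -(count_avoidE (p_monic Hp) (p_size Hp) Hcop).
rewrite /b_count (@card_polys _ j.+1); last by move=> l /= [_ -> _].
rewrite -natz natr_sum; apply: eq_bigl => l.
apply/idP/and3P => [|[ml /eqP sl /(avoidsP Hp) av]]; rewrite inE /=.
  by move=> [ml -> av]; split=> //; apply/(avoidsP Hp).
by split.
Qed.

Lemma bhatE j : bhat iota n j = hatb k n j.
Proof. by apply: eq_bigr => i _; apply: bE. Qed.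

Lemma memP G (f : {poly k}) : (f \in @P k (G%:Z - 1)) = SQ G f.
Proof.
have szE : ((size f)%:Z - 1 = 2 * (G%:Z - 1) + 1 \/
    (size f)%:Z - 1 = 2 * (G%:Z - 1) + 2) <-> (2 * G <= size f <= (2 * G).+1)%N.
  split=> [[] H|/andP[s1 s2]]; lia.
apply/idP/andP; rewrite inE; first by move=> [sq /szE]; split; first exact/asboolP.
by move=> [/asboolP sq /szE]; split.
Qed.

Lemma sum_P_U r alpha G :
  \sum_(f \in @P k (G%:Z - 1))
    \prod_(i < m) chi2 iota (n i) (evalP1 iota (G%:Z - 1) f (alpha i)) ^+ r i
  = U iota n r alpha G.
Proof.
rewrite (@fsbig_polys _ _ (2 * G).+1); last first.
  by move=> f fP; have /and3P[] : SQ G f by rewrite -memP; apply: mem_set.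
have e2 : absz (2 * (G%:Z - 1) + 2) = (2 * G)%N by lia.
rewrite /U (eq_bigl _ _ (memP G)); apply: eq_bigr => f _.
by apply: eq_bigr => i _; rewrite /evalP1 /evp e2.
Qed.

(** One tuple in A(n) supplies points of exact degree n_i, hence lists of the fields k_{n_i}, and
    these bound the entries of every other tuple. *)
Lemma finite_A : finite_set (A iota n).
Proof.
case: (pselect (A iota n !=set0)) => [[alpha0 A0]|/set0P/negP/negPn/eqP->]; last first.
  exact: finite_set0.
have [p [Hp _ _]] := tuple_minpolys n_gt0 A0.
pose s := None :: [seq Some x | x <- flatten
  [seq exts iota (n i) (pt alpha0 i) | i : 'I_m]].
have Hs alpha i : A iota n alpha -> alpha i \in s.
  case=> /(_ i) + _; case: (alpha i) => [x|_]; last exact: mem_head.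
  move=> /(mem_exts (exact_pt Hp i)) xi; rewrite inE /= mem_map; last by move=> ? ? [].
  by apply/flatten_mapP; exists i; rewrite ?mem_enum.
apply: (@sub_finite_set _ _
  [set [ffun i => ssval (f i)] | f in [set: {ffun 'I_m -> seq_sub s}]]).
  move=> alpha Aa; exists [ffun i => SeqSub (Hs alpha i Aa)] => //.
  by apply/ffunP => i; rewrite !ffunE.
by apply: finite_image; apply: finite_finset.
Qed.

Lemma pointwise r alpha G : (0 < m)%N -> (forall i, 0 < r i)%N -> A iota n alpha ->
  \sum_(0 <= j < G.+1) (bhat iota n j)%:~R * U iota n r alpha (G - j)
  = \sum_(h <- polys k (2 * G).+1) Phi iota n r alpha G h.
Proof.
move=> m0 r0 HA; have [p [Hp Hcop Hoo]] := tuple_minpolys n_gt0 HA.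
rewrite -(sum_hatb Hp Hcop Hoo r0 _ m0); apply: eq_bigr => j _.
by rewrite bhatE.
Qed.

Lemma sum_bhat_u r G : (0 < m)%N -> (forall i, 0 < r i)%N ->
  \sum_(0 <= j < G.+1) (bhat iota n j)%:~R * u iota n r (G%:Z - 1 - j%:Z)
  = \sum_(alpha <- fset_set (A iota n))
      I k * \sum_(h <- polys k (2 * G).+1) Phi iota n r alpha G h.
Proof.
move=> m0 r0.
transitivity (\sum_(0 <= j < G.+1) \sum_(alpha <- fset_set (A iota n))
   I k * ((bhat iota n j)%:~R * U iota n r alpha (G - j))).
  apply: eq_big_nat => j /andP[_ jG].
  rewrite /u fsbig_finite ?mulr_sumr; last exact: finite_A.
  apply: eq_bigr => alpha _; rewrite mulrCA.
  have -> : G%:Z - 1 - j%:Z = (G - j)%N%:Z - 1 by lia.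
  by rewrite sum_P_U.
rewrite exchange_big big_seq [RHS]big_seq; apply: eq_bigr => alpha.
rewrite in_fset_set ?inE; last exact: finite_A.
by move=> Aa; rewrite -pointwise // mulr_sumr.
Qed.
End Global.

Theorem theorem4p12 (k : finFieldType) (q_odd : odd #|k|)
    (K : closedFieldType) (iota : {rmorphism k -> K})
    (alg_iota : integralRange iota)
    (m : nat) (m_ge1 : (1 <= m)%N) (n r : 'I_m -> nat) (nr : in_calN n r)
    (g : int) (g_ge : -1 <= g) :
  ((forall i, r i = 2%N) ->
     \sum_(0 <= j < absz (g + 2)) (bhat iota n j)%:~R * u iota n r (g - j%:Z)
     = J iota n * (bhat iota n (absz (2 * g + 2)))%:~R) /\
  ((exists i, r i = 1%N) ->
     ((\sum_(i < m) n i)%N%:R - 3) / 2 <= g%:~R :> rat ->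
     \sum_(0 <= j < absz (g + 2)) (bhat iota n j)%:~R * u iota n r (g - j%:Z)
     = 0).
Proof.
have n_gt0 i : (0 < n i)%N by have [] := nr i.
have r_gt0 i : (0 < r i)%N by have [_ []->] := nr i.
have [G eG] : exists G : nat, g = G%:Z - 1 by exists (absz (g + 1)); lia.
have -> : absz (g + 2) = G.+1 by lia.
have -> : absz (2 * g + 2) = (2 * G)%N by lia.
rewrite {}eG in g_ge *; rewrite sum_bhat_u //; split=> [r2|[i ri] nG].
  rewrite (eq_big_seq (fun=> I k * ((#|k|%:R - 1) * (bhat iota n (2 * G))%:~R))).
    rewrite big_const_seq count_predT iter_addr_0 /J -mulr_natr.
    by ring.
  move=> alpha; rewrite in_fset_set ?inE; last exact: finite_A.
  move=> HA; have [p [Hp Hcop Hoo]] := tuple_minpolys n_gt0 HA.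
  by rewrite (sum_Phi_sqr Hp Hcop Hoo) // bhatE.
rewrite big_seq big1 // => alpha; rewrite in_fset_set ?inE; last exact: finite_A.
move=> HA; have [p [Hp Hcop Hoo]] := tuple_minpolys n_gt0 HA.
rewrite (sum_Phi_odd Hp Hcop Hoo q_odd ri) ?mulr0 //.
(* With g = G - 1, the bound on g says that |n| <= 2G + 1. *)
move: nG; rewrite ler_pdivrMr // lerBlDr => H.
rewrite -(ler_nat rat); apply: le_trans H _.
by rewrite rmorphB /= -!pmulrn; lra.
Qed.
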